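(* Let $q\ge2$, $k\ge 2$ and $w,w'\in[q]^k$. Suppose that condition $D(w,w')$ holds, with witnessing permutations $\pi_i$ ($1\le i\le k-1$). Then $h(X_{\{w\}})\ge h(X_{\{w'\}})$. If $d_i(a)<d_i'(\pi_i(a))$ for some $1\le i\le k-2$ and $a\in[q]$, or if $L_w$ and $L_{w'}$ are both irreducible and $d_{k-1}(a)<d_{k-1}'(\pi_{k-1}(a))$ for some $a\in[q]$, then the entropy inequality is strict: $h(X_{\{w\}})>h(X_{\{w'\}})$.
   Context: $[q]=\{0,\dots,q-1\}$. $X_{\{w\}}\subset[q]^{\mathbb Z}$ is the set of bi-infinite sequences that do not contain $w$; $h(X)=\lim_{n\to\infty}\frac1n\log|\mathcal B_n(X)|$, where $\mathcal B_n(X)$ is the set of words of length $n$ occurring in elements of $X$. For $w=w_1\cdots w_k\in[q]^k$, $a\in[q]$ and $1\le i\le k-1$, let $d_i(a)=\max\{j : 1\le j\le i+1,\ w_1w_2\cdots w_j = w_{i-j+2}w_{i-j+3}\cdots w_i a\}$ (the length of the longest prefix of $w$ that is a suffix of $w_1\cdots w_i a$), with $d_i(a)=*a$ (a formal symbol) if the set of such $j$ is empty. Let $d_i'$ denote the corresponding function for $w'$. By convention $*a<j$ for every $a\in[q]$ and every integer $j\ge1$, and all symbols $*a$, $*b$ are regarded as equal for the purposes of comparison. Condition $D(w,w')$: for each $i\in\{1,\dots,k-1\}$ there exists a permutation $\pi_i:[q]\to[q]$ such that $d_i(a)\le d_i'(\pi_i(a))$ for all $a\in[q]$. $L_w$ is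 the directed edge-labeled graph with vertex set $\{*a: a\in[q]\setminus\{w_1\}\}\cup\{1,2,\dots,k-1\}$ and the following edges: for each $a,b\in[q]\setminus\{w_1\}$, an edge $*a\to *b$ labeled $b$; for each $a\in[q]\setminus\{w_1\}$, an edge $*a\to 1$ labeled $w_1$; for each $a\in[q]$ and $1\le i\le k-1$, except for $a=w_k$ and $i=k-1$, an edge $i\to d_i(a)$ labeled $a$. A directed graph is irreducible if for every ordered pair of vertices $I,J$ there is a directed path from $I$ to $J$. *)

(* Defs.v *)
From HB Require Import structures.
From mathcomp Require Import all_boot all_order all_algebra all_fingroup.
From mathcomp Require Import all_classical all_reals all_analysis.

Set Implicit Arguments.
Unset Strict Implicit.
Unset Printing Implicit Defensive.

Import Order.TTheory GRing.Theory Num.Theory.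
Import numFieldNormedType.Exports.

Local Open Scope classical_set_scope.

Definition occurs (q : nat) (u : seq 'I_q) (x : int -> 'I_q) : Prop :=
  exists p : int, [seq x (p + j%:Z)%R | j <- iota 0 (size u)] = u.

Definition avoiding (q : nat) (w : seq 'I_q) : set (int -> 'I_q) :=
  [set x | ~ occurs w x].

Definition language (q : nat) (X : set (int -> 'I_q)) (n : nat) :
    {set n.-tuple 'I_q} :=
  [set u : n.-tuple 'I_q | `[< exists2 x, X x & occurs u x >]]%SET.

Definition entropy (R : realType) (q : nat) (X : set (int -> 'I_q)) : R :=
  lim ((ln (#|language X n|%:R : R) / n%:R)%R @[n --> \oo]).

(* [Star a] is the formal symbol *a. *)
Inductive state (q : nat) : Type := Star of 'I_q | Pos of nat.
Arguments Star {q} _.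
Arguments Pos {q} _.

Section StateEq.
Variable q : nat.

Definition sum_of_state (s : state q) : 'I_q + nat :=
  match s with Star a => inl a | Pos j => inr j end.

Definition state_of_sum (s : 'I_q + nat) : state q :=
  match s with inl a => Star a | inr j => Pos j end.

Lemma sum_of_stateK : cancel sum_of_state state_of_sum.
Proof. by case. Qed.

HB.instance Definition _ := Equality.copy (state q) (can_type sum_of_stateK).

End StateEq.

(* All the symbols *a are equal for comparison, and below every integer. *)
Definition state_le (q : nat) (s t : state q) : bool :=
  match s, t with
  | Star _, _ => true
  | Pos _, Star _ => false
  | Pos i, Pos j => i <= j
  end.

Definition state_lt (q : nat) (s t : state q) : bool :=
  match s, t with
  | Star _, Star _ => false
  | Star _, Pos _ => true
  | Pos _, Star _ => false
  | Pos i, Pos j => i < j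
  end.

(* The last j letters of w_1 ... w_i a are w_(i-j+2) ... w_i a; the maximum
   over an empty range is 0. *)
Definition d (q : nat) (w : seq 'I_q) (i : nat) (a : 'I_q) : state q :=
  let m := \max_(1 <= j < i.+2 |
                 take j w == drop (i.+1 - j) (rcons (take i w) a)) j in
  if m == 0 then Star a else Pos m.

Definition dominated (q : nat) (w w' : seq 'I_q) (i : nat) (s : {perm 'I_q}) :
    Prop :=
  forall a : 'I_q, state_le (d w i a) (d w' i (s a)).

Definition conditionD (q k : nat) (w w' : k.-tuple 'I_q) : Prop :=
  forall i : nat, 1 <= i <= k - 1 -> exists s : {perm 'I_q}, dominated w w' i s.

(* Letters are numbered from 1. *)
Definition letter_is (q : nat) (w : seq 'I_q) (i : nat) (a : 'I_q) : bool :=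
  onth w i.-1 == Some a.

Definition vertex (q k : nat) (w : k.-tuple 'I_q) (v : state q) : bool :=
  match v with
  | Star a => ~~ letter_is w 1 a
  | Pos i => 1 <= i <= k - 1
  end.

(* [edge w u a v]: L_w has an edge u -> v labeled a. *)
Definition edge (q k : nat) (w : k.-tuple 'I_q) (u : state q) (a : 'I_q)
    (v : state q) : bool :=
  vertex w u &&
  match u with
  | Star _ => if letter_is w 1 a then v == Pos 1 else v == Star a
  | Pos i => ~~ (letter_is w k a && (i == k - 1)) && (v == d w i a)
  end.

Definition adjacent (q k : nat) (w : k.-tuple 'I_q) : rel (state q) :=
  fun u v => [exists a, edge w u a v].

Definition irreducible (q k : nat) (w : k.-tuple 'I_q) : Prop :=
  forall u v : state q, vertex w u -> vertex w v ->
  exists2 p : seq (state q), path (adjacent w) u p & last u p = v.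

(* Main.v *)
Require Import Defs.
From mathcomp Require Import all_boot all_order all_algebra all_fingroup.
From mathcomp Require Import all_classical all_reals all_analysis.
From mathcomp Require Import zify ring lra.

(** Words that avoid [w] are read by an automaton whose state is the length of
    the longest prefix of [w] that ends the part already read; its transition
    function [next] is [d] with every symbol *a sent to 0.

    Let k be the length of [w], and let c_i(x) be the sum of x^j over the
    lengths j of the nonempty borders of w_1 ... w_i, the whole word included
    ([border_poly]). A nonempty prefix of [w] that ends w_1 ... w_i a is a
    prefix of [w] that ends w_1 ... w_i, possibly empty, followed by a. Hence
    the sum over a of c_(next i a) is x (1 + c_i), and v_i = c_k - c_i satisfies
      v_k = 0,   sum over a of v_(next i a) = x v_i - phi(x),
    where phi(x) = x - (q - x) c_k(x) ([defect_poly]). So v is an explicit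
    eigenvector of the automaton where phi vanishes, and a supersolution where
    phi is positive. Let l be the greatest zero of phi in [1, q]. A minimum
    principle shows that c_0 < c_1 < ... < c_k on (l, q] ([border_increasing]).
    In particular v is positive there, and counting words with v squeezes the
    number of words of length n that avoid [w] between l^n and C x^n for every
    x > l. The entropy is therefore log l ([entropy_growth]).

    Let l' be the rate of [w']. As c increases, condition D makes the v of [w] a
    supersolution for the automaton of [w'] as well. If l < l', take x = l' and
    compare it with the eigenvector v' of [w']: where v'/v is maximal, the
    strict inequality phi(l') > 0 is contradicted. So l' <= l. If l' = l, the
    same comparison at x = l only shows that the states where v'/v is maximal
    are closed under transitions ([no_positive_eigenvector]); this is a
    contradiction if all states of [w'] lead to one where the supersolution is
    strict. That is how a strict inequality between d and d' is used.

    What remains is to see that all states lead to the given one, and that c is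
    strictly increasing at l itself. If the automata are irreducible, the first
    is clear, and the second follows because irreducibility makes v positive.
    For a strict inequality at some i <= k - 2, every state returns to 1 except
    for the words 0...01 over two letters ([reaches1_or_no_fallback]). Such a
    word cannot be [w'], since its transitions are the smallest possible, and if
    it is [w], the recurrence for c shows directly that c increases. *)

Set Implicit Arguments.
Unset Strict Implicit.
Unset Printing Implicit Defensive.
Import Order.TTheory GRing.Theory Num.Theory.
Import numFieldNormedType.Exports.

(** * The prefix automaton of a word *)

Section Overlap.
Variable q : nat.
Implicit Types (w u : seq 'I_q) (a : 'I_q) (i j m : nat).

Definition overlap w u : nat :=
  \max_(j < (size w).+1 | suffix (take j w) u) j.

Definition next w i a : nat := overlap w (rcons (take i w) a).

Lemma overlap_suffix w u : suffix (take (overlap w u) w) u.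
Proof.
have h0 : suffix (take (@ord0 (size w)) w) u by rewrite take0 suffix0s.
by rewrite /overlap (bigop.bigmax_eq_arg ord0) //; case: arg_maxnP.
Qed.

Lemma overlap_le w u : overlap w u <= size w.
Proof. by apply/bigmax_leqP => j _; rewrite -ltnS. Qed.

Lemma le_overlap w u j : j <= size w -> suffix (take j w) u -> j <= overlap w u.
Proof.
move=> hj hs; rewrite -ltnS in hj.
exact: (@leq_bigmax_cond _ (fun j : 'I__ => suffix (take j w) u) val (Ordinal hj)).
Qed.

(** Of two suffixes of the same word the shorter is a suffix of the longer, so
    the state of [u] remembers every prefix of [w] that ends [u]. *)
Lemma suffix_overlap w u j : j <= size w ->
  suffix (take j w) (take (overlap w u) w) = suffix (take j w) u.
Proof.
move=> hj; apply/idP/idP => [h|h]; first exact: suffix_trans h (overlap_suffix w u).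
have := le_overlap hj h; have := overlap_le w u.
move: (overlap w u) (overlap_suffix w u) => o ho how hjo.
have /suffixP[s1 e1] := h; have /suffixP[s2 e2] := ho.
have szj : size (take j w) = j by rewrite size_takel.
have szo : size (take o w) = o by rewrite size_takel.
rewrite suffixE szj szo; apply/eqP.
have -> : take j w = drop (size u - j) u.
  by rewrite e1 size_cat szj addnK drop_size_cat.
rewrite e2 size_cat szo drop_cat ltnNge.
have -> : size s2 <= size s2 + o - j by lia.
by rewrite /=; congr (drop _ _); lia.
Qed.

Lemma suffix_take_rcons w u a j (hj : j < size w) :
  suffix (take j.+1 w) (rcons u a) = suffix (take j w) u && (nth a w j == a).
Proof. by rewrite (take_nth a hj) suffix_rcons andbC. Qed.

Lemma eq_overlap w u u' :
  (forall j, 0 < j <= size w -> suffix (take j w) u = suffix (take j w) u') ->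
  overlap w u = overlap w u'.
Proof.
move=> h; apply: eq_bigl => -[[|j] hj] /=; first by rewrite take0 !suffix0s.
by apply: h.
Qed.

(** This is what makes [next] a transition function. *)
Lemma overlap_rcons w u a : overlap w (rcons u a) = next w (overlap w u) a.
Proof.
apply: eq_overlap => -[|j] // /andP[_ hj].
by rewrite !suffix_take_rcons // suffix_overlap // ltnW.
Qed.

Lemma overlap_nil w : overlap w [::] = 0.
Proof.
have := size_suffix (overlap_suffix w [::]).
by rewrite size_takel ?overlap_le //= leqn0 => /eqP.
Qed.

Lemma overlap_full w u : (overlap w u == size w) = suffix w u.
Proof.
apply/idP/idP => [/eqP h|h].
  by have := overlap_suffix w u; rewrite h take_size.
by rewrite eqn_leq overlap_le le_overlap // take_size.
Qed.

Lemma next_le_size w i a : next w i a <= size w.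
Proof. exact: overlap_le. Qed.

Lemma next_le w i a : i <= size w -> next w i a <= i.+1.
Proof.
move=> hi; have := size_suffix (overlap_suffix w (rcons (take i w) a)).
by rewrite size_rcons !size_takel // overlap_le.
Qed.

Lemma next_eqS w i a : i < size w -> (next w i a == i.+1) = (nth a w i == a).
Proof.
move=> hi; apply/idP/idP => h.
  have := overlap_suffix w (rcons (take i w) a).
  by rewrite -/(next w i a) (eqP h) suffix_take_rcons // => /andP[].
rewrite eqn_leq next_le ?(ltnW hi) // le_overlap //.
by rewrite suffix_take_rcons // suffix_refl.
Qed.

Lemma next0 w a : 0 < size w -> next w 0 a = (nth a w 0 == a).
Proof.
move=> hw; have := next_le a (leq0n (size w)); have := next_eqS a hw.
by case: (next w 0 a) => [|[]] // <-.
Qed.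

Lemma next_last w i a m : i <= size w -> next w i a = m.+1 -> nth a w m = a.
Proof.
move=> hi e; have := overlap_suffix w (rcons (take i w) a).
have hm : m < size w by rewrite -e next_le_size.
by rewrite -/(next w i a) e suffix_take_rcons // => /andP[_ /eqP].
Qed.

(** The prefix reached by reading [a] agrees, before its last letter, with the
    end of the prefix that was left. *)
Lemma next_match w i a m t : i <= size w -> next w i a = m.+1 -> t < m ->
  nth a w (m - t.+1) = nth a w (i - t.+1).
Proof.
move=> hi e ht; have := overlap_suffix w (rcons (take i w) a).
have hm : m < size w by rewrite -e next_le_size.
have hmi : m <= i by rewrite -ltnS -e next_le.
rewrite -/(next w i a) e suffix_take_rcons // => /andP[].
rewrite suffixE !size_takel ?(ltnW hm) // => /eqP E _.
have := congr1 (fun s => nth a s (m - t.+1)) E.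
rewrite nth_drop !nth_take; try lia.
by move=> <-; congr nth; lia.
Qed.

End Overlap.

(** * Border polynomials *)

Section BorderPoly.
Local Open Scope ring_scope.
Variables (R : rcfType) (q : nat).
Implicit Types (w u : seq 'I_q) (a : 'I_q) (i j m : nat) (x y : R).

(** The summand of index [j] stands for the border of length [j.+1]. *)
Definition border_poly w i : {poly R} :=
  \sum_(j < size w | suffix (take j.+1 w) (take i w)) 'X^(j.+1).

(** The amount by which [c_m - c_i] fails to be an eigenvector of the automaton
    for the eigenvalue ['X]; see [border_balance]. *)
Definition defect_poly w m : {poly R} :=
  'X - (q%:R%:P - 'X) * border_poly w m.

Lemma border_polyE w i x :
  (border_poly w i).[x] =
  \sum_(j < size w | suffix (take j.+1 w) (take i w)) x ^+ j.+1.
Proof. by rewrite horner_sum; apply: eq_bigr => j _; rewrite hornerXn. Qed.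

Lemma defect_polyE w m x :
  (defect_poly w m).[x] = x - (q%:R - x) * (border_poly w m).[x].
Proof. by rewrite !(hornerD, hornerN, hornerM, hornerX, hornerC). Qed.

Lemma border_poly0 w : border_poly w 0 = 0.
Proof.
rewrite /border_poly big_pred0 // => j.
by rewrite take0 suffixs0 -size_eq0 size_takel.
Qed.

Lemma border_poly_ge0 w i x : 0 <= x -> 0 <= (border_poly w i).[x].
Proof. by move=> hx; rewrite border_polyE sumr_ge0 // => j _; rewrite exprn_ge0. Qed.

Lemma border_poly_ge w m x : 0 <= x -> (0 < m <= size w)%N ->
  x ^+ m <= (border_poly w m).[x].
Proof.
case: m => // m hx hm; rewrite border_polyE (bigD1 (Ordinal hm)) ?suffix_refl //=.
by rewrite lerDl sumr_ge0 // => j _; rewrite exprn_ge0.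
Qed.

(** Removing the last letter [a] turns the prefixes of [w] that end
    [rcons (take i w) a] into those that end [take i w] and are followed by [a]
    in [w]; summing over [a] counts each of the latter once. The leading 1 comes
    from the empty prefix. *)
Lemma sum_border_next w i x : (i < size w)%N ->
  \sum_(a : 'I_q) (border_poly w (next w i a)).[x] =
  x * (1 + (border_poly w i).[x]).
Proof.
move=> hi.
transitivity (\sum_(j < size w | suffix (take j w) (take i w)) x ^+ j.+1).
  under eq_bigr => a _.
    rewrite border_polyE big_mkcond.
    under eq_bigr => j _ do
      rewrite [X in if X then _ else _]suffix_overlap // suffix_take_rcons //.
    over.
  rewrite exchange_big [RHS]big_mkcond; apply: eq_bigr => j _ /=.
  case: ifP => _ /=; last by rewrite big1.
  have [a0 _] : exists a : 'I_q, true.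
    by case: (w) j => [[]//|a0 s] _; exists a0.
  rewrite (bigD1 (nth a0 w j)) //= (set_nth_default a0) // eqxx.
  rewrite big1 ?addr0 // => a ha.
  by rewrite (set_nth_default a0) // eq_sym (negPf ha).
have [k hk] : exists k, size w = k.+1 by case: (size w) hi => // k _; exists k.
rewrite border_polyE hk.
rewrite !(big_mkcond (fun j : 'I_k.+1 => suffix _ _)) /=.
rewrite big_ord_recl take0 suffix0s expr1 big_ord_recr /=.
have -> : suffix (take k.+1 w) (take i w) = false.
  apply/negbTE/negP => /size_suffix.
  by rewrite !size_takel ?(ltnW hi) -?hk // leqNgt hi.
rewrite addr0 mulrDr mulr1; congr (_ + _); rewrite mulr_sumr.
by apply: eq_bigr => j _; rewrite /bump /= add1n; case: ifP; rewrite ?mulr0 ?exprS.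
Qed.

(** The automaton of a prefix [take m w] is that of [w] until state [m] is
    reached, so the identity is needed for all [m], not only for the length of
    [w]. *)
Lemma border_balance w m i x : (i < m <= size w)%N ->
  x * ((border_poly w m).[x] - (border_poly w i).[x]) =
  \sum_(a : 'I_q) ((border_poly w m).[x] - (border_poly w (next w i a)).[x])
    + (defect_poly w m).[x].
Proof.
move=> /andP[him hm]; rewrite sumrB sum_border_next ?(leq_trans him) //.
by rewrite sumr_const card_ord defect_polyE -mulr_natl; ring.
Qed.

Lemma horner_ge0_right_of_roots (p : {poly R}) (a b : R) : a <= b -> 0 < p.[b] ->
  (forall z, a < z <= b -> ~~ root p z) -> 0 <= p.[a].
Proof.
move=> hab hb hr; rewrite leNgt; apply/negP => ha.
have [|z /andP[az zb] rz] := @poly_ivt _ p a b hab; first by rewrite !ltW.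
move: az; rewrite le_eqVlt => /orP[/eqP e|az].
  by move: rz ha; rewrite -e => /eqP ->; rewrite ltxx.
by move: (hr z); rewrite az zb rz => /(_ isT).
Qed.

Lemma greatest_root (p : {poly R}) (a b : R) : p != 0 -> root p a -> a <= b ->
  exists y, [/\ a <= y <= b, root p y & forall z, y < z <= b -> ~~ root p z].
Proof.
have [n] := ubnP (size p); elim: n p a => // n IH p a hn p0 ra hab.
have [s es] := factor_theorem p a ra.
have s0 : s != 0 by apply: contra_neq p0 => s0; rewrite es s0 mul0r.
have [[z /andP[az zb] rz]|hz] := pselect (exists2 z, a < z <= b & root p z).
  have rsz : root s z by move: rz; rewrite es rootM root_XsubC gt_eqF // orbF.
  have szs : (size s < n)%N.
    by move: hn; rewrite es size_Mmonic ?monicXsubC // size_XsubC addn2.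
  have [y [/andP[zy yb] ry hy]] := IH s z szs s0 rsz zb.
  exists y; split => [||t /andP[yt tb]]; first by rewrite yb (le_trans _ zy) // ltW.
    by rewrite es rootM ry.
  rewrite es rootM root_XsubC negb_or hy ?yt //= gt_eqF //.
  by rewrite (lt_trans az) // (le_lt_trans zy).
exists a; split => [||t ht] //; first by rewrite lexx.
by apply/negP => rt; apply: hz; exists t.
Qed.

(** At [x = q] the balance says that [v = c_m - c_i] exceeds by 1 its average
    over the [q] successors of [i]; hence its minimum is attained at [m] only. *)
Lemma border_lt_top w m j : (0 < q)%N -> (j < m <= size w)%N ->
  (border_poly w j).[q%:R] < (border_poly w m).[q%:R].
Proof.
move=> q0 /andP[jm mw]; have qR : 0 < q%:R :> R by rewrite ltr0n.
pose v i := (border_poly w m).[q%:R] - (border_poly w i).[q%:R].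
have bal i : (i < m)%N -> q%:R * v i = \sum_(a : 'I_q) v (next w i a) + q%:R.
  by move=> im; rewrite border_balance ?im // defect_polyE subrr mul0r subr0.
have ge i c : (i < m)%N -> (forall t, (t <= m)%N -> c <= v t) -> c < v i.
  move=> im hc; rewrite -(ltr_pM2l qR) bal // ltr_pwDr //.
  have -> : q%:R * c = \sum_(a : 'I_q) c by rewrite sumr_const card_ord mulr_natl.
  apply: ler_sum => a _; apply/hc/(leq_trans (next_le a _)) => //.
  exact: leq_trans (ltnW im) mw.
pose i0 := [arg min_(i < @ord0 m) v i]%O.
have hmin t : (t <= m)%N -> v i0 <= v t.
  rewrite -ltnS => ht; rewrite /i0; case: arg_minP => // i _ h.
  exact: (h (Ordinal ht)).
have hi0 : i0 = m :> nat.
  apply/eqP; rewrite eqn_leq -ltnS ltn_ord leqNgt; apply/negP => h.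
  by have := ge _ _ h hmin; rewrite ltxx.
by have := ge j _ jm hmin; rewrite hi0 {1}/v subrr subr_gt0.
Qed.

(** Let [x] decrease from [q], where all [c_m - c_i] are positive. At the first
    point [y] where one of them vanishes, the others are still nonnegative, and
    the balance at that [i] reads 0 = nonnegative + positive defect. That point
    is found as the greatest root of the product of the [c_m - c_i]. *)
Lemma border_lt w m j x : (j < m <= size w)%N -> 0 < x <= q%:R ->
  (forall y, x <= y <= q%:R -> 0 < (defect_poly w m).[y]) ->
  (border_poly w j).[x] < (border_poly w m).[x].
Proof.
move=> /andP[jm mw] /andP[x0 xq] hpos.
have q0 : (0 < q)%N by rewrite -(ltr0n R) (lt_le_trans x0).
pose p i := border_poly w m - border_poly w i.
have pE i z : (p i).[z] = (border_poly w m).[z] - (border_poly w i).[z].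
  by rewrite hornerD hornerN.
have ptop i : (i < m)%N -> 0 < (p i).[q%:R].
  by move=> im; rewrite pE subr_gt0 border_lt_top ?im.
rewrite -subr_gt0 -pE ltNge; apply/negP => hle.
have [|r /andP[xr rq] rr] := @poly_ivt _ (p j) x q%:R xq.
  by rewrite hle ltW ?ptop.
pose P := \prod_(i < m) p i.
have rootP z : root P z = [exists i : 'I_m, root (p i) z].
  rewrite /root horner_prod; apply/prodf_eq0/existsP => [[i _ h]|[i h]]; by exists i.
have P0 : P != 0.
  apply/prodf_neq0 => i _; apply: contraTneq (ptop i (ltn_ord i)) => ->.
  by rewrite horner0 ltxx.
have rP : root P r by rewrite rootP; apply/existsP; exists (Ordinal jm).
have [y [/andP[ry yq] Py hy]] := greatest_root P0 rP rq.
have pge i : (i <= m)%N -> 0 <= (p i).[y].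
  rewrite leq_eqVlt => /orP[/eqP ->|im]; first by rewrite pE subrr.
  apply: horner_ge0_right_of_roots yq (ptop i im) _ => z hz.
  by apply: contra (hy z hz) => h; rewrite rootP; apply/existsP; exists (Ordinal im).
move: Py; rewrite rootP => /existsP[i /eqP h].
have := @border_balance w m i y; rewrite ltn_ord mw -pE h mulr0 => /(_ isT).
apply/eqP; rewrite lt_eqF // ltr_wpDl ?hpos ?yq ?(le_trans xr) //.
rewrite sumr_ge0 // => a _; rewrite -pE pge //.
by apply: leq_trans (next_le a _) (ltn_ord i); apply: leq_trans (ltnW _) mw.
Qed.

(** Shortening the prefix decreases [c_m], hence increases the defect: a longer
    forbidden word leaves a larger growth rate. *)
Lemma defect_pred w m x : (m < size w)%N -> 0 < x ->
  (forall y, x <= y <= q%:R -> 0 < (defect_poly w m.+1).[y]) ->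
  forall y, x <= y <= q%:R -> 0 < (defect_poly w m).[y].
Proof.
move=> mw x0 hpos y /andP[xy yq].
have hlt : (border_poly w m).[y] < (border_poly w m.+1).[y].
  apply: border_lt; rewrite ?ltnSn ?yq ?(lt_le_trans x0) // => z /andP[yz zq].
  by rewrite hpos // zq (le_trans xy).
have := hpos y; rewrite xy yq => /(_ isT).
rewrite !defect_polyE !subr_gt0; apply: le_lt_trans.
by apply: ler_wpM2l; [rewrite subr_ge0 | exact: ltW].
Qed.

Lemma border_increasing w n m j x : (j < m <= n)%N -> (n <= size w)%N ->
  0 < x <= q%:R ->
  (forall y, x <= y <= q%:R -> 0 < (defect_poly w n).[y]) ->
  (border_poly w j).[x] < (border_poly w m).[x].
Proof.
move=> /andP[jm mn] nw xq; rewrite -(subnK mn); move: (n - m)%N (subnK mn) => t.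
move=> e; have tmw : (t + m <= size w)%N by rewrite e.
elim: t tmw {e} => [|t IH] tmw hpos.
  by apply: border_lt hpos; rewrite ?jm.
by apply: IH; [exact: ltnW | apply: defect_pred hpos => //; case/andP: xq].
Qed.

(** The greatest zero of the defect, which is the exponential growth rate of the
    number of words that avoid [w]. *)
Definition is_growth w (l : R) :=
  [/\ 1 <= l < q%:R, root (defect_poly w (size w)) l &
    forall y, l < y <= q%:R -> 0 < (defect_poly w (size w)).[y]].

Lemma growth_exists w : (2 <= q)%N -> (0 < size w)%N -> exists l, is_growth w l.
Proof.
move=> q2 w0; pose p := defect_poly w (size w).
have q1 : 1 <= q%:R :> R by rewrite ler1n ltnW.
have pq : 0 < p.[q%:R] by rewrite defect_polyE subrr mul0r subr0 ltr0n ltnW.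
have p1 : p.[1] <= 0.
  rewrite defect_polyE subr_le0 -[X in X <= _]mulr1 ler_pM //.
    by rewrite lerBrDr -[1 + 1]/(2%:R) ler_nat.
  by have := @border_poly_ge w (size w) 1 ler01; rewrite w0 leqnn expr1n; apply.
have [|r /andP[r1 rq] rr] := @poly_ivt _ p 1 q%:R q1; first by rewrite p1 ltW.
have p0 : p != 0 by apply: contraTneq pq => ->; rewrite horner0 ltxx.
have [l [/andP[rl lq] rootl hl]] := greatest_root p0 rr rq.
exists l; split => // [|y /andP[ly yq]].
  rewrite (le_trans r1) //= lt_neqAle lq andbT; apply: contraTneq pq => <-.
  by rewrite (eqP rootl) ltxx.
rewrite lt_neqAle eq_sym; have := hl y; rewrite ly yq => /(_ isT) -> /=.
apply: horner_ge0_right_of_roots yq pq _ => z /andP[yz zq]; apply: hl.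
by rewrite zq (lt_trans ly).
Qed.

Lemma growth_border_lt w l x j m : is_growth w l -> l < x <= q%:R ->
  (j < m <= size w)%N -> (border_poly w j).[x] < (border_poly w m).[x].
Proof.
move=> [/andP[l1 _] _ hl] /andP[lx xq] jm.
apply: (@border_increasing w (size w)) => // [|y /andP[xy yq]].
  by rewrite xq andbT (lt_trans _ lx) // (lt_le_trans ltr01).
by rewrite hl // yq (lt_le_trans lx).
Qed.

Lemma growth_border_le w l j m : is_growth w l -> (j <= m <= size w)%N ->
  (border_poly w j).[l] <= (border_poly w m).[l].
Proof.
move=> Hl /andP[]; rewrite leq_eqVlt => /orP[/eqP -> //|jm] mw.
have [/andP[l1 lq] _ _] := Hl.
have lt x : l < x <= q%:R -> 0 < (border_poly w m - border_poly w j).[x].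
  move=> hx; rewrite hornerD hornerN subr_gt0.
  by apply: growth_border_lt hx _ => //; rewrite jm.
rewrite -subr_ge0 -hornerN -hornerD.
apply: horner_ge0_right_of_roots (ltW lq) (lt _ _) _ => [|z hz].
  by rewrite lq lexx.
by rewrite /root gt_eqF // lt.
Qed.

(** If [c_n < c_(n+1)] at [l], where the defect of the whole word vanishes, then
    the defect of its prefix of length [n] is positive from [l] on: the prefix
    has a smaller growth rate, and [l] is to the right of it. *)
Lemma growth_border_lt_at w l n j m : is_growth w l -> size w = n.+1 ->
  (border_poly w n).[l] < (border_poly w (size w)).[l] ->
  (j < m <= n)%N -> (border_poly w j).[l] < (border_poly w m).[l].
Proof.
move=> [/andP[l1 lq] rl hl] hn hlt jm; have l0 := lt_le_trans ltr01 l1.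
apply: (@border_increasing w n) => //; rewrite ?hn ?l0 ?ltW //.
move=> y /andP[]; rewrite le_eqVlt => /orP[/eqP <- _|ly yq].
  move: rl; rewrite /root defect_polyE subr_eq0 => /eqP e.
  by rewrite defect_polyE {1}e subr_gt0 ltr_pM2l // subr_gt0.
apply: (@defect_pred w n y); rewrite ?hn ?lexx ?(lt_trans l0) //.
move=> z /andP[yz zq]; rewrite -hn hl // zq andbT; exact: lt_le_trans yz.
Qed.

End BorderPoly.

(** * Reachability in the automaton *)

Section Reach.
Variable q : nat.
Implicit Types (w : seq 'I_q) (T : nat -> Prop) (i : nat).

(** Paths stay among the states below [size w]: state [size w] means that [w] has
    occurred. *)
Inductive reaches w T : nat -> Prop :=
| reaches_here i of T i : reaches w T i
| reaches_next i a of next w i a < size w & reaches w T (next w i a) :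
    reaches w T i.

Lemma reaches_trans w T T' i :
  (forall j, T j -> reaches w T' j) -> reaches w T i -> reaches w T' i.
Proof. by move=> h; elim=> // {}i a ha _; apply: reaches_next. Qed.

Lemma exists_letter w i : i < size w -> exists a, nth a w i = a.
Proof.
case: w => [//|a0 s] hi; exists (nth a0 (a0 :: s) i).
exact: set_nth_default.
Qed.

Lemma reaches_up w i j : i <= j < size w -> reaches w (eq^~ j) i.
Proof.
move=> /andP[ij jw]; rewrite -(subKn ij); have := leq_subr i j.
elim: (j - i) => [|t IH] tj; first by rewrite subn0; apply: reaches_here.
have hlt : j - t.+1 < size w by lia.
have [a ea] := exists_letter hlt.
have en : next w (j - t.+1) a = j - t.
  by have := next_eqS a hlt; rewrite ea eqxx => /eqP ->; lia.
apply: (@reaches_next _ _ _ a); rewrite en; first by lia.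
by apply: IH; lia.
Qed.

Lemma other_letter (c : 'I_q) : 1 < q -> exists a, a != c.
Proof.
move=> q2; have q0 : 0 < q by apply: ltnW.
have [->|] := eqVneq c (Ordinal q0); first by exists (Ordinal q2).
by rewrite eq_sym; exists (Ordinal q0).
Qed.

(** For words of length at least 2 this says that all letters before the last one
    are equal. Only such words can have a state that does not lead back to 1:
    over two letters, the last state of 0...01 leads only to itself. *)
Definition no_fallback w :=
  forall i a, i.+1 < size w -> nth a w i != a -> next w i a = 0.

(** From a state [i >= 2], every letter other than the next letter [b] of [w]
    leads to a state that is at most [i]. If none of them leads below [i], then
    w_1 ... w_i consists of copies of one letter different from [b]. Now either
    [b] is the last letter of [w], or reading [b] and then a letter that does
    not continue [w] leads to 0 or 1, because a longer match would put [b] into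
    the constant part. *)
Lemma reaches1_or_no_fallback w : 1 < q -> 1 < size w ->
  (forall i, i < size w -> reaches w (eq^~ 1) i) \/ no_fallback w.
Proof.
move=> q2 w2; have [nf|nf] := pselect (no_fallback w); [by right|left].
elim/ltn_ind => -[|[|j]] IH jw; [exact: reaches_up|exact: reaches_here|].
set i := j.+2 in IH jw *.
have [[a ha nai]|stuck] := pselect (exists2 a, next w i a < i & nth a w i != a).
  apply: (reaches_next (a := a)); first exact: ltn_trans ha jw.
  exact: IH _ ha (ltn_trans ha jw).
have stay a : nth a w i != a -> next w i a = i.
  move=> ha; have := next_le a (ltnW jw); have := next_eqS a jw.
  rewrite (negPf ha) => /negbT ne; rewrite leq_eqVlt (negPf ne) ltnS /=.
  rewrite leq_eqVlt => /orP[/eqP //|lt]; case: stuck; by exists a.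
have [b eb] := exists_letter jw.
have [a nab] := other_letter b q2.
have nai : nth a w i != a.
  by rewrite (set_nth_default b) // eb eq_sym.
have ei := stay a nai.
have step t : t < j.+1 -> nth a w t = nth a w t.+1.
  move=> tj; have := @next_match _ w i a j.+1 (j - t) (ltnW jw) ei.
  have -> : j.+1 - (j - t).+1 = t by lia.
  have -> : i - (j - t).+1 = t.+1 by lia.
  by apply; lia.
have back t : t <= j.+1 -> nth a w (j.+1 - t) = a.
  elim: t => [|t IHt] tj; first by rewrite subn0; apply: next_last (ltnW jw) ei.
  rewrite step; last by lia.
  have -> : (j.+1 - t.+1).+1 = j.+1 - t by lia.
  by apply: IHt; lia.
have const t : t < i -> nth a w t = a.
  by move=> ti; have := back (j.+1 - t); rewrite subKn //; apply; apply: leq_subr.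
(* [w] is constant except for its last letter, or continues after [b]. *)
have [iw|iw] := ltnP i.+1 (size w); last first.
  case: nf => t c tw ntc; case E: (next w t c) => [//|m].
  have tw' := ltnW tw.
  have hm : m <= t by rewrite -ltnS -E next_le // ltnW.
  have := next_last (ltnW tw') E; rewrite (set_nth_default a);
    last exact: leq_ltn_trans hm tw'.
  have ti : t < i by rewrite -ltnS (leq_trans tw iw).
  rewrite const ?(leq_ltn_trans hm ti) // => eac.
  by move: ntc; rewrite -eac const ?eqxx.
have [c0 ec0] := exists_letter iw.
have [c nc] := other_letter c0 q2.
have nci : nth c w i.+1 != c.
  by rewrite (set_nth_default c0) // ec0 eq_sym.
have enb : next w i b = i.+1 by have := next_eqS b jw; rewrite eb eqxx => /eqP.
apply: (reaches_next (a := b)); rewrite enb //.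
have small : next w i.+1 c <= 1.
  case E: (next w i.+1 c) => [//|[//|m]]; exfalso.
  have hm : m.+1 <= i.
    have := next_le c (ltnW iw); have := next_eqS c iw.
    by rewrite (negPf nci) E => /negbT; lia.
  have := @next_match _ w i.+1 c m.+1 0 (ltnW iw) E isT.
  have mi : m < i by apply: leq_trans hm.
  rewrite !subSS !subn0 (set_nth_default a) ?(ltn_trans mi) // const //.
  by rewrite (set_nth_default b) // eb => e; move: nab; rewrite e eqxx.
apply: (reaches_next (a := c)).
  by apply: leq_ltn_trans small _.
by apply: IH; lia.
Qed.

End Reach.

(** * Supersolutions and eigenvectors *)

Section Comparison.
Local Open Scope ring_scope.
Variables (R : realFieldType) (q : nat) (w : seq 'I_q) (x : R) (v : nat -> R).
Let k := size w.
Hypothesis x0 : 0 < x.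
Hypothesis v_ge0 : forall i, (i <= k)%N -> 0 <= v i.
Hypothesis v_sup : forall i, (i < k)%N ->
  \sum_(a : 'I_q) v (next w i a) <= x * v i.

Lemma supersolution_gt0 i : (i < k)%N ->
  reaches w (fun j => (j < k)%N -> 0 < v j) i -> 0 < v i.
Proof.
move=> ik hr; elim: hr ik => {i} [i hi|i a ha _ IH] ik; first exact: hi.
rewrite -(pmulr_rgt0 _ x0); apply: lt_le_trans (v_sup ik).
rewrite (bigD1 a) //= ltr_pwDl ?IH // sumr_ge0 // => b _.
by rewrite v_ge0 ?next_le_size.
Qed.

Lemma strict_supersolution_gt0 i : (i < k)%N ->
  \sum_(a : 'I_q) v (next w i a) < x * v i -> 0 < v i.
Proof.
move=> ik h; rewrite -(pmulr_rgt0 _ x0); apply: le_lt_trans h.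
by rewrite sumr_ge0 // => a _; rewrite v_ge0 ?next_le_size.
Qed.

(** At a state where [v' / v] takes its maximum [C > 0], the eigenvalue equation
    for [v'] and the inequality for [v] force equality at all successors, so the
    maximum propagates along paths until it meets a state where the inequality
    for [v] is strict. Positivity of [v] also comes from those states. *)
Lemma no_positive_eigenvector (v' : nat -> R) :
  (forall i, (i < k)%N -> reaches w (fun j => (j < k)%N ->
     \sum_(a : 'I_q) v (next w j a) < x * v j) i) ->
  (forall i, (i < k)%N -> \sum_(a : 'I_q) v' (next w i a) = x * v' i) ->
  v' k = 0 -> (0 < k)%N -> v' 0 <= 0.
Proof.
move=> hr hv' v'k k0; rewrite leNgt; apply/negP => v'0.
have v_gt0 i : (i < k)%N -> 0 < v i.
  move=> ik; apply: supersolution_gt0 => //; apply: reaches_trans (hr i ik).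
  by move=> j hj; apply: reaches_here => jk; apply: strict_supersolution_gt0 (hj jk).
pose i0 := [arg max_(i > Ordinal k0) (v' i / v i)]%O.
pose C := v' i0 / v i0.
have hC i : (i < k)%N -> v' i <= C * v i.
  move=> ik; rewrite -ler_pdivrMr ?v_gt0 // /C /i0; case: arg_maxP => // j _ h.
  exact: (h (Ordinal ik)).
have C0 : 0 < C by rewrite -(pmulr_lgt0 _ (v_gt0 _ k0)) (lt_le_trans v'0) ?hC.
have hCk i : (i <= k)%N -> v' i <= C * v i.
  rewrite leq_eqVlt => /orP[/eqP ->|]; last exact: hC.
  by rewrite v'k mulr_ge0 ?v_ge0 // ltW.
have max0 : v' i0 = C * v i0 by rewrite /C divfK // gt_eqF ?v_gt0.
have hle i : (i < k)%N ->
    \sum_(a : 'I_q) v' (next w i a) <= C * \sum_(a : 'I_q) v (next w i a).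
  by move=> ik; rewrite mulr_sumr; apply: ler_sum => a _; rewrite hCk ?next_le_size.
have := hr i0 (ltn_ord i0); move: max0 (ltn_ord i0).
move: (nat_of_ord i0) => i + + h.
elim: h => {}i.
  move=> hi max ik; have := hle i ik; rewrite hv' // max mulrCA leNgt.
  by rewrite ltr_pM2l // hi.
move=> a ha _ IH max ik; apply: IH => //; apply/eqP.
rewrite eq_le hCk ?next_le_size //=.
rewrite leNgt; apply/negP => lt.
suff : \sum_(b : 'I_q) v' (next w i b) < C * \sum_(b : 'I_q) v (next w i b).
  by rewrite hv' // max mulrCA ltr_pM2l // ltNge v_sup.
rewrite mulr_sumr [X in X < _](bigD1 a) //= [X in _ < X](bigD1 a) //= ltr_leD //.
by apply: ler_sum => b _; rewrite hCk ?next_le_size.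
Qed.

End Comparison.

(** * Counting the words that avoid a word *)

Section Counting.
Variable q : nat.
Implicit Types (w p : seq 'I_q).

Definition avoid_count w n p : nat :=
  #|[set u : n.-tuple 'I_q | ~~ infix w (p ++ u)]|.

Lemma avoid_countE w n p :
  avoid_count w n p = \sum_(u : n.-tuple 'I_q) ~~ infix w (p ++ u).
Proof. by rewrite /avoid_count cardsE -sum1_card big_mkcond. Qed.

Lemma avoid_count0 w p : avoid_count w 0 p = ~~ infix w p.
Proof.
rewrite avoid_countE (bigD1 [tuple]) //= cats0 big1 ?addn0 // => u.
by rewrite tuple0.
Qed.

Lemma avoid_countS w n p :
  avoid_count w n.+1 p = \sum_(a : 'I_q) avoid_count w n (rcons p a).
Proof.
rewrite avoid_countE; under [RHS]eq_bigr => a _ do rewrite avoid_countE.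
rewrite pair_bigA /=.
rewrite (reindex (fun z : 'I_q * n.-tuple 'I_q => [tuple of z.1 :: z.2])) /=.
  by apply: eq_bigr => -[a u] _ /=; rewrite cat_rcons.
exists (fun u : n.+1.-tuple 'I_q => (thead u, [tuple of behead u])) => [[a u] _|u _].
  by congr pair; apply: val_inj.
by rewrite /= -tuple_eta.
Qed.

Lemma avoid_count_infix w n p : infix w p -> avoid_count w n p = 0.
Proof.
by move=> h; rewrite avoid_countE big1 // => u _; rewrite infix_catr.
Qed.

Lemma overlap_lt w p : ~~ infix w p -> overlap w p < size w.
Proof.
move=> hp; rewrite ltn_neqAle overlap_le andbT overlap_full.
by apply: contra hp; apply: suffixW.
Qed.

Lemma overlap_rcons_infix w p a : ~~ infix w p -> infix w (rcons p a) ->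
  overlap w (rcons p a) = size w.
Proof.
move=> hp; rewrite infix_rconsl (negPf hp) orbF => h.
by apply/eqP; rewrite overlap_full.
Qed.

Local Open Scope ring_scope.
Variables (R : realFieldType) (x : R) (v : nat -> R) (w : seq 'I_q).
Hypotheses (x0 : 0 <= x) (vk : v (size w) = 0).

(** The counts follow the transitions of the automaton, so they grow at least as
    fast as a subsolution and at most as fast as a supersolution. *)
Lemma avoid_count_ge (M : R) n p : 0 <= M ->
  (forall i, (i < size w)%N -> v i <= M) ->
  (forall i, (i < size w)%N -> x * v i <= \sum_(a : 'I_q) v (next w i a)) ->
  ~~ infix w p -> x ^+ n * v (overlap w p) <= M * (avoid_count w n p)%:R.
Proof.
move=> M0 vM hv; elim: n p => [|n IH] p hp.
  by rewrite expr0 mul1r avoid_count0 hp mulr1 vM ?overlap_lt.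
rewrite avoid_countS natr_sum mulr_sumr exprSr -mulrA.
apply: le_trans (ler_wpM2l (exprn_ge0 n x0) (hv _ (overlap_lt hp))) _.
rewrite mulr_sumr; apply: ler_sum => a _; rewrite -overlap_rcons.
have [h|h] := boolP (infix w (rcons p a)); last exact: IH.
by rewrite overlap_rcons_infix // vk mulr0 mulr_ge0.
Qed.

Lemma avoid_count_le (e : R) n p :
  (forall i, (i < size w)%N -> e <= v i) ->
  (forall i, (i < size w)%N -> \sum_(a : 'I_q) v (next w i a) <= x * v i) ->
  ~~ infix w p -> e * (avoid_count w n p)%:R <= x ^+ n * v (overlap w p).
Proof.
move=> ev hv; elim: n p => [|n IH] p hp.
  by rewrite expr0 mul1r avoid_count0 hp mulr1 ev ?overlap_lt.
rewrite avoid_countS natr_sum mulr_sumr exprSr -mulrA.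
apply: le_trans (ler_wpM2l (exprn_ge0 n x0) (hv _ (overlap_lt hp))).
rewrite mulr_sumr; apply: ler_sum => a _; rewrite -overlap_rcons.
have [h|h] := boolP (infix w (rcons p a)); last exact: IH.
by rewrite overlap_rcons_infix // vk mulr0 avoid_count_infix // mulr0.
Qed.

End Counting.

(** * The language of the shift *)

Section Language.
Variable q : nat.
Implicit Types (w u : seq 'I_q).

Lemma occursP u (x : int -> 'I_q) :
  occurs u x <->
  exists p : int, forall j a, j < size u -> nth a u j = x (p + j%:Z)%R.
Proof.
split=> -[p hp]; exists p.
  move=> j a ju; rewrite -[in LHS]hp (nth_map 0) ?size_iota // nth_iota //.
apply: (@eq_from_nth _ (x p)); rewrite size_map size_iota // => j ju.
by rewrite (nth_map 0) ?size_iota // nth_iota // (hp j).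
Qed.

Lemma infix_nth w u :
  (exists2 p, p + size w <= size u &
     forall j a, j < size w -> nth a w j = nth a u (p + j)) <->
  infix w u.
Proof.
split=> [[p pw hp]|/infixP[s [s' ->]]].
  have -> : w = take (size w) (drop p u).
    case: u pw hp => [|a u] pw hp.
      by move: pw; rewrite leqn0 addn_eq0 => /andP[_ /nilP ->].
    apply: (@eq_from_nth _ a) => [|j jw].
      by rewrite size_takel // size_drop; lia.
    by rewrite nth_take // nth_drop hp.
  exact: infix_trans (infix_take _ _) (infix_drop _ _).
exists (size s); first by rewrite !size_cat leq_add2l leq_addr.
move=> j a jw; rewrite nth_cat ltnNge leq_addr /= addnC addnK nth_cat jw //.
Qed.

(** A word that avoids [w] extends to a bi-infinite sequence that avoids [w]:
    repeat on its right a letter other than the last one of [w], and on its left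
    a letter other than the first one of [w]. *)
Lemma card_language w n : 1 < q -> 0 < size w ->
  #|language (avoiding w) n| = avoid_count w n [::].
Proof.
move=> q2 w0; apply: eq_card => u; rewrite !inE /=.
apply/asboolP/idP => [[x hx ux]|hu].
  apply/negP => hi; apply: hx; move: hi => /infix_nth[p pw hp].
  move/occursP: ux => [r hr]; apply/occursP; exists (r + p%:Z)%R => j a jw.
  by rewrite hp // hr; [congr x; lia | lia].
have [a ea] := exists_letter w0.
have [al na] := other_letter a q2.
have w0' : (size w).-1 < size w by rewrite prednK.
have [b eb] := exists_letter w0'.
have [be nb] := other_letter b q2.
pose x (t : int) := if t is Posz m then nth be u m else al.
have xE m : x (Posz m) = nth be u m by [].
have xN m : x (Negz m) = al by [].
exists x; last first.
  apply/occursP; exists 0%R => j c ju; rewrite add0r xE.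
  exact: set_nth_default.
move=> /occursP[p hp]; case: p hp => p hp.
  have pw : p + size w <= size u.
    rewrite leqNgt; apply/negP => lt.
    have := hp _ b w0'; rewrite eb -PoszD xE nth_default => [e|].
      by move: nb; rewrite e eqxx.
    by rewrite -ltnS -addnS prednK.
  move/negP: hu; apply; apply/infix_nth; exists p => // j c jw.
  rewrite (hp j c jw) -PoszD xE; apply: set_nth_default.
  by apply: leq_trans pw; rewrite ltn_add2l.
have := hp 0 a w0; rewrite ea addr0 xN => e.
by move: na; rewrite e eqxx.
Qed.
End Language.

(** * Entropy as the logarithm of the growth rate *)

Section Entropy.
Local Open Scope ring_scope.
Variables (R : realType) (q : nat) (w : seq 'I_q) (l : R).
Hypotheses (w0 : (0 < size w)%N) (Hl : is_growth w l).

Lemma growth_count_ge n : l ^+ n <= (avoid_count w n [::])%:R.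
Proof.
have [/andP[l1 _] rl _] := Hl; have l0 := lt_le_trans ltr01 l1.
pose K := (border_poly R w (size w)).[l].
have K0 : 0 < K.
  by apply: lt_le_trans (border_poly_ge (ltW l0) _); rewrite ?exprn_gt0 // w0 /=.
have := @avoid_count_ge q R l (fun i => K - (border_poly R w i).[l]) w (ltW l0)
  (subrr _) K n [::] (ltW K0).
rewrite overlap_nil border_poly0 horner0 subr0 mulrC ler_pM2l //; apply.
- by move=> i _; rewrite gerBl border_poly_ge0 // ltW.
- by move=> i iw; rewrite /K border_balance ?iw /= ?leqnn // (eqP rl) addr0.
- by rewrite infixs0 -size_eq0 -lt0n.
Qed.

Lemma growth_count_le x : l < x <= q%:R ->
  exists2 C : R, 0 < C & forall n, (avoid_count w n [::])%:R <= C * x ^+ n.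
Proof.
have [/andP[l1 _] _ hl] := Hl; move=> hx; have /andP[lx xq] := hx.
have x0 : 0 < x by rewrite (lt_trans _ lx) // (lt_le_trans ltr01).
pose K := (border_poly R w (size w)).[x]; pose d0 := (defect_poly R w (size w)).[x].
have d_gt0 : 0 < d0 by apply: hl.
have K0 : 0 < K.
  by apply: lt_le_trans (border_poly_ge (ltW x0) _); rewrite ?exprn_gt0 // w0 /=.
have v_ge0 i : (i <= size w)%N -> 0 <= K - (border_poly R w i).[x].
  rewrite leq_eqVlt => /orP[/eqP ->|iw]; first by rewrite subrr.
  by rewrite subr_ge0 ltW // (growth_border_lt Hl hx) ?iw /=.
exists (K / (d0 / x)) => [|n]; first by rewrite !divr_gt0.
have := @avoid_count_le q R x (fun i => K - (border_poly R w i).[x]) w (ltW x0)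
  (subrr _) (d0 / x) n [::].
rewrite overlap_nil border_poly0 horner0 subr0 => h.
rewrite mulrAC ler_pdivlMr ?divr_gt0 // mulrC [K * _]mulrC h //.
- move=> i iw; rewrite ler_pdivrMr // mulrC border_balance ?iw //= lerDr.
  by rewrite sumr_ge0 // => a _; rewrite v_ge0 ?next_le_size.
- by move=> i iw; rewrite border_balance ?iw //= lerDl ltW.
- by rewrite infixs0 -size_eq0 -lt0n.
Qed.

Lemma entropy_growth : entropy R (avoiding w) = ln l.
Proof.
have [/andP[l1 lq] _ _] := Hl; have l0 := lt_le_trans ltr01 l1.
have q2 : (1 < q)%N by rewrite -(ltr1n R) (le_lt_trans l1).
rewrite /entropy; under eq_fun do rewrite card_language //.
apply: cvg_lim => //; apply/cvgrPdist_le => e e0.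
pose x := Num.min (l * expR (e / 2)) q%:R.
have lx : l < x <= q%:R.
  by rewrite ge_min lexx orbT andbT lt_min lq andbT ltr_pMr // expR_gt1 divr_gt0.
have x0 : 0 < x by case/andP: lx => + _; apply: lt_trans.
have lnx : ln x <= ln l + e / 2.
  rewrite -[X in _ + X]expRK -lnM ?posrE ?expR_gt0 //.
  by rewrite ler_ln ?posrE ?mulr_gt0 ?expR_gt0 // ge_min lexx.
have [C C0 hC] := growth_count_le lx.
near=> n.
have n0 : 0 < n%:R :> R by near: n; apply: nbhs_infty_gtr.
have N0 : 0 < (avoid_count w n [::])%:R :> R.
  by apply: lt_le_trans (growth_count_ge n); rewrite exprn_gt0.
have lo : n%:R * ln l <= ln ((avoid_count w n [::])%:R : R).
  by rewrite mulr_natl -lnXn // ler_ln ?posrE ?exprn_gt0 // growth_count_ge.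
have hi : ln ((avoid_count w n [::])%:R : R) <= ln C + n%:R * ln x.
  rewrite mulr_natl -lnXn // -lnM ?posrE ?exprn_gt0 //.
  by rewrite ler_ln ?posrE ?mulr_gt0 ?exprn_gt0.
have hn : ln C / (e / 2) <= n%:R by near: n; apply: nbhs_infty_ger.
rewrite distrC ger0_norm; last by rewrite subr_ge0 ler_pdivlMr // mulrC.
rewrite lerBlDr ler_pdivrMr // (le_trans hi) //.
move: hn; rewrite ler_pdivrMr ?divr_gt0 // => hn.
have : n%:R * ln x <= n%:R * (ln l + e / 2) by rewrite ler_pM2l.
move: hn; lra.
Unshelve. all: by end_near. Qed.

End Entropy.

(** * The graph L_w and the prefix automaton *)

Section Link.
Variable q : nat.
Implicit Types (w : seq 'I_q) (s : state q).

Definition level s : nat := if s is Pos i then i else 0.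

Lemma d_next w i a : i < size w ->
  d w i a = if next w i a == 0 then Star a else Pos (next w i a).
Proof.
move=> iw; rewrite /d; set m := \max_(1 <= j < i.+2 | _) j.
have suf j : 1 <= j < i.+2 ->
    suffix (take j w) (rcons (take i w) a) =
    (take j w == drop (i.+1 - j) (rcons (take i w) a)).
  move=> /andP[j1 ji]; have jw : j <= size w by apply: leq_trans iw.
  by rewrite suffixE size_rcons !size_takel ?(ltnW iw) // eq_sym.
suff -> : m = next w i a by [].
apply/eqP; rewrite eqn_leq; apply/andP; split.
  apply/bigmax_leqP_seq => j; rewrite mem_index_iota => hj.
  rewrite -suf //; apply: le_overlap; case/andP: hj => _ hj.
  by apply: leq_trans iw.
have hs := overlap_suffix w (rcons (take i w) a).
have := next_le a (ltnW iw); rewrite /next in hs *.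
case: (overlap _ _) hs => // n hs hn.
apply: (@leq_bigmax_seq _ _
  (fun j => take j w == drop (i.+1 - j) (rcons (take i w) a)) id).
  by rewrite mem_index_iota.
by rewrite -suf.
Qed.

Lemma level_d w i a : i < size w -> level (d w i a) = next w i a.
Proof. by move=> iw; rewrite d_next //; case: eqP => [->|]. Qed.

Lemma state_le_d w w' i a b : i < size w -> i < size w' ->
  state_le (d w i a) (d w' i b) = (next w i a <= next w' i b).
Proof.
move=> iw iw'; rewrite !d_next //.
by case: (next w i a) (next w' i b) => [|m] [|n].
Qed.

Lemma state_lt_d w w' i a b : i < size w -> i < size w' ->
  state_lt (d w i a) (d w' i b) = (next w i a < next w' i b).
Proof.
move=> iw iw'; rewrite !d_next //.
by case: (next w i a) (next w' i b) => [|m] [|n].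
Qed.

Lemma letter_isE w i a : i < size w -> letter_is w i.+1 a = (nth a w i == a).
Proof. by move=> iw; rewrite /letter_is /= onthE (nth_map a). Qed.

(** An edge never leads to level [k], since the edge that completes [w] is left
    out of the graph. *)
Lemma edge_next k (w : k.-tuple 'I_q) u a v : 1 < k -> edge w u a v ->
  level v = next w (level u) a /\ level v < k.
Proof.
move=> k2; have szw := size_tuple w.
have w0 : 0 < size w by rewrite szw ltnW.
case: u => [c|i] /andP[/= hu].
  rewrite letter_isE //= next0 //.
  by case: eqP => _ /eqP -> //=; split=> //; apply: ltnW.
move=> /andP[hd /eqP ->].
have ik : i < k by move: hu k2; clear; lia.
rewrite level_d ?szw //; split => //.
have := next_le_size w i a; rewrite szw ltn_neqAle => ->; rewrite andbT.
apply: contra hd => /eqP e.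
have ei : i.+1 = k.
  apply/eqP; rewrite eqn_leq ik -e; apply: next_le; rewrite szw; exact: ltnW.
have := next_eqS a (_ : i < size w); rewrite szw ik => /(_ isT).
rewrite e ei eqxx => /esym h.
have -> : letter_is w k a = letter_is w i.+1 a by rewrite ei.
by rewrite letter_isE ?szw // h -ei subn1 eqxx.
Qed.

Lemma irreducible_reaches k (w : k.-tuple 'I_q) i j : 1 < q -> 1 < k ->
  irreducible w -> i < k -> j < k -> reaches w (eq^~ j) i.
Proof.
move=> q2 k2 irr ik jk; have szw := size_tuple w.
have w0 : 0 < size w by rewrite szw ltnW.
have ex t : t < k -> exists2 u, vertex w u & level u = t.
  case: t => [_|t tk]; last by exists (Pos t.+1) => //=; move: tk; clear; lia.
  have [c ec] := exists_letter w0; have [b nb] := other_letter c q2.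
  exists (Star b) => //=; rewrite letter_isE //.
  by rewrite (set_nth_default c) // ec eq_sym.
have [u hu <-] := ex i ik; have [v hv <-] := ex j jk.
have [p] := irr u v hu hv; elim: p u {hu} => [|t p IH] u /=.
  by move=> _ <-; apply: reaches_here.
move=> /andP[/existsP[a /(edge_next k2)[e lt]] hp] el.
apply: (reaches_next (a := a)); rewrite -e ?szw //; exact: IH.
Qed.

End Link.

(** * Comparison of growth rates *)

Section Growth.
Local Open Scope ring_scope.
Variables (R : realType) (q : nat).
Implicit Types (w : seq 'I_q) (l : R).

Notation c := (border_poly R).

(** At the growth rate [c_k - c_i] is an eigenvector, and the set where it is
    positive contains every state that leads into it. *)
Lemma growth_gap_gt0 w l i T : is_growth w l -> (i < size w)%N ->
  reaches w T i -> (forall j, T j -> (c w j).[l] < (c w (size w)).[l]) ->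
  (c w i).[l] < (c w (size w)).[l].
Proof.
move=> Hl iw hr hT; have [/andP[l1 _] rl _] := Hl.
have l0 := lt_le_trans ltr01 l1; rewrite -subr_gt0.
apply: (@supersolution_gt0 R q w l
  (fun i => (c w (size w)).[l] - (c w i).[l])) => //.
- by move=> j jw; rewrite subr_ge0 growth_border_le // jw leqnn.
- by move=> j jw; rewrite border_balance ?jw ?leqnn // (eqP rl) addr0.
by apply: reaches_trans hr => j /hT; rewrite -subr_gt0 => h; apply: reaches_here.
Qed.

Lemma border_poly_size_gt0 w (x : R) : 0 < x -> (0 < size w)%N ->
  0 < (c w (size w)).[x].
Proof.
move=> x0 w0; apply: lt_le_trans (border_poly_ge (ltW x0) _); first exact: exprn_gt0.
by rewrite w0 leqnn.
Qed.

(** The defect is negative at 3/2: there c_k >= (3/2)^3 and q - 3/2 >= 1/2. For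
    length 2 and two letters the claim fails: the word 01 has growth rate 1. *)
Lemma growth_gt1 w l : is_growth w l -> (2 < size w)%N -> 1 < l.
Proof.
move=> [/andP[l1 lq] _ hl] w3; rewrite ltNge; apply/negP => l_le.
have q2 : 2%:R <= q%:R :> R.
  by rewrite ler_nat -(ltr_nat R) (le_lt_trans l1).
pose x : R := 3%:R / 2%:R.
have x1 : 1 <= x by rewrite /x; lra.
have lxq : l < x <= q%:R by apply/andP; split; rewrite /x; lra.
have hx := hl x lxq; rewrite defect_polyE in hx.
have hc : x ^+ 3 <= (c w (size w)).[x].
  apply: le_trans (border_poly_ge _ _); [exact: ler_weXn2l| lra|lia].
have : x ^+ 3 / 2%:R <= (q%:R - x) * (c w (size w)).[x].
  rewrite mulrC; apply: ler_pM => //; rewrite ?exprn_ge0 /x //; lra.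
move: hx; rewrite /x; lra.
Qed.

Lemma border_poly1 w (x : R) : (0 < size w)%N -> (c w 1).[x] = x.
Proof.
move=> w0; rewrite border_polyE (big_pred1 (Ordinal w0)) // => j.
rewrite /= -val_eqE /=; case: j => -[|j] hj /=; first by rewrite suffix_refl.
by apply/negP => /size_suffix; rewrite !size_takel.
Qed.

Lemma growth_gap1 w l : is_growth w l -> (2 < size w)%N ->
  (c w 1).[l] < (c w (size w)).[l].
Proof.
move=> Hl w3; have l1 := growth_gt1 Hl w3.
have l0 := lt_trans ltr01 l1.
rewrite border_poly1; last by apply: leq_trans w3.
apply: lt_le_trans (border_poly_ge (ltW l0) _).
  by rewrite -[X in X < _]expr1 ltr_eXn2l //; apply: leq_trans w3.
by rewrite leqnn andbT (leq_trans _ w3).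
Qed.

(** Here state [i] leads to [i.+1] by one letter and to 0 by all others, so the
    recurrence is c_(i+1) = x (1 + c_i) > c_i. *)
Lemma no_fallback_border_lt w (x : R) j m : no_fallback w -> 1 <= x ->
  (j < m)%N -> (m < size w)%N -> (c w j).[x] < (c w m).[x].
Proof.
move=> nf x1; have x0 := lt_le_trans ltr01 x1.
have step i : (i.+1 < size w)%N -> (c w i).[x] < (c w i.+1).[x].
  move=> iw; have [b eb] := exists_letter (ltnW iw).
  have := sum_border_next x (ltnW iw); rewrite (bigD1 b) //= big1 => [|a nab].
    have := next_eqS b (ltnW iw); rewrite eb eqxx => /eqP ->; rewrite addr0 => ->.
    have := border_poly_ge0 w i (ltW x0); move: x1; nra.
  rewrite (nf i a iw) ?border_poly0 ?horner0 //.
  by rewrite (set_nth_default b) ?(ltnW iw) // eb eq_sym.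
elim: m => // m IH; rewrite ltnS leq_eqVlt => /orP[/eqP -> /step //|jm] mw.
by apply: lt_trans (IH jm (ltnW mw)) (step m mw).
Qed.

Lemma sum_gap_next_le w w' (v : nat -> R) i (s : {perm 'I_q}) :
  (forall j m, (j <= m <= size w')%N -> v m <= v j) ->
  (forall a, (next w i a <= next w' i (s a))%N) ->
  \sum_(a : 'I_q) v (next w' i a) <= \sum_(a : 'I_q) v (next w i a).
Proof.
move=> hv hs; rewrite (reindex_perm s) /=; apply: ler_sum => a _.
by apply: hv; rewrite hs next_le_size.
Qed.

Lemma sum_gap_next_lt w w' (v : nat -> R) i (s : {perm 'I_q}) a :
  (forall j m, (j <= m <= size w')%N -> v m <= v j) ->
  (forall a, (next w i a <= next w' i (s a))%N) ->
  v (next w' i (s a)) < v (next w i a) ->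
  \sum_(a : 'I_q) v (next w' i a) < \sum_(a : 'I_q) v (next w i a).
Proof.
move=> hv hs lt; rewrite (reindex_perm s) /= (bigD1 a) //= [X in _ < X](bigD1 a) //=.
by rewrite ltr_leD //; apply: ler_sum => b _; apply: hv; rewrite hs next_le_size.
Qed.

Variables (w w' : seq 'I_q) (l l' : R).
Hypotheses (eqw : size w' = size w) (w0 : (0 < size w)%N).
Hypotheses (Hl : is_growth w l) (Hl' : is_growth w' l').
Hypothesis dom : forall i, (i < size w)%N ->
  exists s : {perm 'I_q}, forall a, (next w i a <= next w' i (s a))%N.

(** If [l < l'], then at [x = l'] the defect of [w] is positive, so that the
    supersolution is strict at every state. *)
Lemma growth_le : l' <= l.
Proof.
rewrite leNgt; apply/negP => ll'.
have [/andP[l'1 l'q] rl' _] := Hl'; have l'0 := lt_le_trans ltr01 l'1.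
have [_ _ hl] := Hl; have ll'q : l < l' <= q%:R by rewrite ll' ltW.
pose v i := (c w (size w)).[l'] - (c w i).[l'].
have v_anti j m : (j <= m <= size w')%N -> v m <= v j.
  rewrite eqw => /andP[]; rewrite leq_eqVlt => /orP[/eqP -> //|jm mw].
  by rewrite lerB // ltW // (growth_border_lt Hl) // jm.
have v_strict i : (i < size w)%N -> \sum_(a : 'I_q) v (next w' i a) < l' * v i.
  move=> iw; have [s hs] := dom iw; apply: le_lt_trans (sum_gap_next_le v_anti hs) _.
  by rewrite /v border_balance ?iw ?leqnn // ltrDl hl.
have := @no_positive_eigenvector R q w' l' v l'0 _ _
  (fun i => (c w' (size w')).[l'] - (c w' i).[l']).
rewrite border_poly0 horner0 subr0 subrr leNgt border_poly_size_gt0 ?eqw //.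
move=> h; suff : false by []; apply: h => // [i iw|i iw|i iw|i iw].
- by rewrite (le_trans _ (v_anti i (size w) _)) ?eqw ?iw ?leqnn // /v subrr.
- by rewrite ltW // v_strict.
- by apply: reaches_here => _; apply: v_strict.
- by rewrite -eqw border_balance ?eqw ?iw ?leqnn // -eqw (eqP rl') addr0.
Qed.

(** If [l' = l], the defect of [w] vanishes there, and the only strictness is the
    one at state [i]. *)
Lemma growth_lt i (s : {perm 'I_q}) a : (i < size w)%N ->
  (forall j, (j < size w)%N -> reaches w' (eq^~ i) j) ->
  (forall b, (next w i b <= next w' i (s b))%N) ->
  (c w (next w i a)).[l] < (c w (next w' i (s a))).[l] -> l' < l.
Proof.
move=> iw hr hs lt; rewrite lt_neqAle growth_le andbT; apply/eqP => e.
have [/andP[l1 lq] rl _] := Hl; have l0 := lt_le_trans ltr01 l1.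
have [_ rl' _] := Hl'; rewrite e in rl'.
pose v i := (c w (size w)).[l] - (c w i).[l].
have v_anti j m : (j <= m <= size w')%N -> v m <= v j.
  by rewrite eqw => h; rewrite lerB // (growth_border_le Hl).
have v_eig j : (j < size w)%N -> \sum_(b : 'I_q) v (next w j b) = l * v j.
  by move=> jw; rewrite /v border_balance ?jw ?leqnn // (eqP rl) addr0.
have := @no_positive_eigenvector R q w' l v l0 _ _
  (fun i => (c w' (size w')).[l] - (c w' i).[l]).
rewrite border_poly0 horner0 subr0 subrr leNgt border_poly_size_gt0 ?eqw //.
move=> h; suff : false by []; apply: h => // [j jw|j jw|j jw|j jw].
- by rewrite (le_trans _ (v_anti j (size w) _)) ?eqw ?jw ?leqnn // /v subrr.
- by have [s' hs'] := dom jw; rewrite -v_eig //; apply: sum_gap_next_le hs'.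
- apply: reaches_trans (hr j jw) => t ->; apply: reaches_here => _.
  rewrite -v_eig //; apply: (sum_gap_next_lt (s := s) (a := a)) => //.
  by rewrite /v ltrD2l ltrN2.
- by rewrite -eqw border_balance ?eqw ?jw ?leqnn // -eqw (eqP rl') addr0.
Qed.

End Growth.

(** * The strict inequality *)

Section StrictGap.
Local Open Scope ring_scope.
Variables (R : realType) (q : nat) (w w' : seq 'I_q) (l : R).
Hypotheses (eqw : size w' = size w) (Hl : is_growth w l).
Notation c := (border_poly R).

(** In the automaton of [w'] only the letter w'_(i+1) leads to a positive state,
    so [s] must send w_(i+1) to it; a strict inequality at [a] would force
    [s a] to be the same letter. *)
Lemma no_fallback_not_dominated_strict i (s : {perm 'I_q}) a :
  no_fallback w' -> (i.+1 < size w)%N ->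
  (forall b, (next w i b <= next w' i (s b))%N) ->
  ~ (next w i a < next w' i (s a))%N.
Proof.
move=> nf iw hs lt; have iw0 := ltnW iw.
have iw' : (i < size w')%N by rewrite eqw.
have only b : (0 < next w' i b)%N -> nth b w' i = b.
  by move=> h; apply/eqP/negPn/negP => ne; move: h; rewrite nf // eqw.
have sa := only (s a) (leq_ltn_trans (leq0n _) lt).
have [b eb] := exists_letter iw0.
have nb : next w i b = i.+1 by apply/eqP; rewrite next_eqS // eb.
have sb : nth (s b) w' i = s b by apply: only; apply: leq_trans (hs b); rewrite nb.
have /perm_inj ab : s a = s b by rewrite -sa (set_nth_default (s b)) ?sb.
have := next_le (s a) (ltnW iw'); rewrite leqNgt; move: lt; rewrite ab nb.
by move=> ->.
Qed.

(** If all states return to 1, then [c_k - c_i] is positive at the last state, as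
    it is at 1. Otherwise it can vanish at the last state: for 0...01 the growth
    rate is that of the word without its last letter. *)
Lemma growth_border_lt_inner j m : (1 < q)%N -> (2 < size w)%N ->
  (j < m)%N -> (m < size w)%N -> (c w j).[l] < (c w m).[l].
Proof.
move=> q2 w3 jm mw; have [/andP[l1 _] _ _] := Hl.
have [hr|nf] := reaches1_or_no_fallback q2 (ltnW w3); last first.
  exact: no_fallback_border_lt.
have wE : size w = (size w).-1.+1 by rewrite prednK // (leq_trans _ w3).
have lw : ((size w).-1 < size w)%N by rewrite -wE.
apply: (growth_border_lt_at Hl wE) => //; last by rewrite jm -ltnS -wE.
by apply: (growth_gap_gt0 Hl lw (hr _ lw)) => t ->; apply: growth_gap1.
Qed.

End StrictGap.

Theorem theorem3p15 (R : realType) (q k : nat) (w w' : k.-tuple 'I_q)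
    (hq : 2 <= q) (hk : 2 <= k)
    (hD : conditionD w w') :
  (entropy R (avoiding w') <= entropy R (avoiding w))%R /\
  (forall pi : nat -> {perm 'I_q},
     (forall i : nat, 1 <= i <= k - 1 -> dominated w w' i (pi i)) ->
     (exists (i : nat) (a : 'I_q),
        1 <= i <= k - 2 /\ state_lt (d w i a) (d w' i (pi i a))) \/
     (irreducible w /\ irreducible w' /\
      exists a : 'I_q, state_lt (d w (k - 1) a) (d w' (k - 1) (pi (k - 1) a))) ->
     (entropy R (avoiding w') < entropy R (avoiding w))%R).
Proof.
have szw := size_tuple w; have szw' := size_tuple w'.
have eqw : size w' = size w by rewrite szw szw'.
have w0 : 0 < size w by rewrite szw ltnW.
have w0' : 0 < size w' by rewrite eqw.
have [l Hl] := growth_exists R hq w0; have [l' Hl'] := growth_exists R hq w0'.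
rewrite (entropy_growth w0 Hl) (entropy_growth w0' Hl').
have pos (u : seq 'I_q) (t : R) : is_growth u t -> (0 < t)%R.
  by case=> /andP[t1 _] _ _; apply: lt_le_trans t1.
have l0 := pos _ _ Hl; have l'0 := pos _ _ Hl'.
have domE i (s : {perm 'I_q}) : i < k -> dominated w w' i s ->
    forall a, next w i a <= next w' i (s a).
  by move=> ik hs a; have := hs a; rewrite state_le_d ?szw ?szw'.
have dom i : i < size w ->
    exists s : {perm 'I_q}, forall a, next w i a <= next w' i (s a).
  case: i => [_|i iw].
    have [a ea] := exists_letter w0; have [b eb] := exists_letter w0'.
    (* state 0, which condition D leaves out: match the first letters *)
    exists (tperm a b) => c; rewrite !next0 //.
    have [e|//] := eqVneq (nth c w 0) c.
    have -> : c = a by rewrite -e (set_nth_default a).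
    by rewrite tpermL eb eqxx.
  rewrite szw in iw; have hi : 1 <= i.+1 <= k - 1 by move: iw; clear; lia.
  by have [s hs] := hD _ hi; exists s; apply: domE.
split; first by rewrite ler_ln ?posrE // (growth_le eqw w0 Hl Hl' dom).
move=> pi hpi hstrict; rewrite ltr_ln ?posrE //.
have crit i a : 1 <= i <= k - 1 ->
    (forall j, j < k -> reaches w' (eq^~ i) j) ->
    ((border_poly R w (next w i a)).[l] <
     (border_poly R w (next w' i (pi i a))).[l])%R ->
    (l' < l)%R.
  move=> hi hr; have ik : i < k by move: hi hk; clear; lia.
  apply: (growth_lt eqw w0 Hl Hl' dom) => //; rewrite ?szw //.
  exact: domE (hpi i hi).
case: hstrict => [[i [a [hi lt]]]|[irr [irr' [a lt]]]].
  have hi1 : 1 <= i <= k - 1 by move: hi; clear; lia.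
  have iw : i.+1 < size w by rewrite szw; move: hi hk; clear; lia.
  have ik : i < k by rewrite -szw ltnW.
  have i1 : 1 <= i by case/andP: hi.
  have w3 : 2 < size w by apply: leq_ltn_trans iw.
  rewrite state_lt_d ?szw ?szw' // in lt.
  have hs := domE i _ ik (hpi i hi1).
  apply: (crit i a hi1) => [j jk|].
    have w2' : 1 < size w' by rewrite eqw ltnW.
    have [hr|nf] := reaches1_or_no_fallback hq w2'; last first.
      by case: (no_fallback_not_dominated_strict eqw nf iw hs lt).
    apply: reaches_trans (hr j _); last by rewrite szw'.
    by move=> t ->; apply: reaches_up; rewrite i1 szw'.
  apply: (growth_border_lt_inner Hl) => //.
  by apply: leq_ltn_trans iw; apply: next_le; rewrite szw' ltnW.
have k1 : k - 1 < k by move: hk; clear; lia.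
have hk1 : 1 <= k - 1 <= k - 1 by move: hk; clear; lia.
rewrite state_lt_d ?szw ?szw' // in lt.
apply: (crit (k - 1) a hk1) => [j jk|]; first exact: irreducible_reaches.
have gap j : j < k -> ((border_poly R w j).[l] < (border_poly R w (size w)).[l])%R.
  move=> jk; apply: (@growth_gap_gt0 R q w l j (eq^~ 0) Hl); first by rewrite szw.
    by apply: irreducible_reaches => //; apply: ltnW.
  by move=> t ->; rewrite border_poly0 horner0 border_poly_size_gt0.
have := next_le_size w' (k - 1) (pi (k - 1) a); rewrite eqw leq_eqVlt.
case/orP => [/eqP e|mk].
  by rewrite e gap //; move: lt; rewrite e szw.
apply: (@growth_border_lt_at R q w l (k - 1)) => //.
- by rewrite szw subn1 prednK // ltnW.
- exact: gap.
- by rewrite lt /=; move: mk hk; rewrite szw; clear; lia.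
Qed.
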